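(* Let $V \in \mathbb{C}^{r \times N}$ with $VV^* = I$. Then in $O(Nr^2)$ operations it is possible to find an invertible submatrix $\hat V \in \mathbb{C}^{r \times r}$ of $V$ such that $$\| \hat V^{-1} \|_F \leqslant \sqrt{r ( N - r + 1 )}$$ and $$\| \hat V^{-1} \|_2 \leqslant \sqrt{1 + r ( N - r )} .$$
   Context: A submatrix $\hat V \in \mathbb{C}^{r\times r}$ of $V\in\mathbb{C}^{r\times N}$ is formed by $r$ distinct columns of $V$. $\|\cdot\|_F$ is the Frobenius norm, $\|\cdot\|_2$ the spectral norm, $V^*$ the conjugate transpose. Operations are elementary exact arithmetic operations (including square roots and comparisons of real numbers); the constant in $O(\cdot)$ is absolute. *)

(* Defs.v *)
From mathcomp Require Import all_boot all_order all_algebra.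
From mathcomp Require Import all_reals.
From mathcomp Require Import complex.

Set Implicit Arguments.
Unset Strict Implicit.
Unset Printing Implicit Defensive.

Import Order.TTheory GRing.Theory Num.Theory.
Local Open Scope ring_scope.

(* Norms of complex matrices.  The norm `|z| of R[i] takes its values in R[i]
   (with zero imaginary part), whence the complex.Re. *)

Definition adjoint (R : realType) (m n : nat) (A : 'M[R[i]]_(m, n)) :
    'M[R[i]]_(n, m) :=
  map_mx Num.conj A^T.

Definition frobnorm (R : realType) (m n : nat) (A : 'M[R[i]]_(m, n)) : R :=
  Num.sqrt (\sum_(i < m) \sum_(j < n) complex.Re `|A i j| ^+ 2).

(* On a column the Frobenius norm is the Euclidean norm, so this is the operator
   norm induced by the Euclidean norms.  The set is nonempty and bounded
   (finite dimension), hence sup is a genuine supremum. *)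
Definition specnorm (R : realType) (m n : nat) (A : 'M[R[i]]_(m, n)) : R :=
  sup (fun y : R => exists2 x : 'cV[R[i]]_n,
         frobnorm x <= 1 & y = frobnorm (A *m x)).

(* A real random access machine, presented as a small structured language.
   Programs are finite syntax, so one program serves all dimensions and all
   inputs, and they contain no real constants other than natural numbers.  The
   memory consists of natural-number variables, one-dimensional arrays of
   natural numbers (used for indices) and two-dimensional arrays of reals, all
   named by natural numbers.  Loop bounds are evaluated once, on entry, so the
   evaluator is total. *)

Inductive iexpr : Type :=
| ILit of nat
| IVar of nat
| IGet of nat & iexpr              (* array, position *)
| IAdd of iexpr & iexpr
| ISub of iexpr & iexpr.           (* truncated *)

Inductive rexpr : Type :=
| RLit of nat
| RGet of nat & iexpr & iexpr      (* array, row, column *)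
| RAdd of rexpr & rexpr
| RSub of rexpr & rexpr
| RMul of rexpr & rexpr
| RDiv of rexpr & rexpr
| RSqrt of rexpr.

Inductive test : Type :=
| ILe of iexpr & iexpr
| RLe of rexpr & rexpr.

Inductive cmd : Type :=
| Skip
| Seq of cmd & cmd
| SetVar of nat & iexpr
| SetInt of nat & iexpr & iexpr             (* array, position, value *)
| SetReal of nat & iexpr & iexpr & rexpr    (* array, row, column, value *)
| If of test & cmd & cmd
| For of nat & iexpr & cmd.  (* For x e c: x runs through 0, ..., e - 1 *)

Record state (R : realType) : Type := State {
  vars : nat -> nat;
  ints : nat -> nat -> nat;
  reals : nat -> nat -> nat -> R
}.

Definition set_var (R : realType) (s : state R) (x v : nat) : state R :=
  State (fun y => if y == x then v else vars s y) (ints s) (reals s).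

Definition set_int (R : realType) (s : state R) (a i v : nat) : state R :=
  State (vars s)
    (fun b j => if (b == a) && (j == i) then v else ints s b j)
    (reals s).

Definition set_real (R : realType) (s : state R) (a i j : nat) (v : R) :
    state R :=
  State (vars s) (ints s)
    (fun b k l => if [&& b == a, k == i & l == j] then v else reals s b k l).

Fixpoint ieval (R : realType) (s : state R) (e : iexpr) : nat :=
  match e with
  | ILit n => n
  | IVar x => vars s x
  | IGet a e1 => ints s a (ieval s e1)
  | IAdd e1 e2 => (ieval s e1 + ieval s e2)%N
  | ISub e1 e2 => (ieval s e1 - ieval s e2)%N
  end.

(* x / 0 = 0, and the square root of a negative number is 0. *)
Fixpoint reval (R : realType) (s : state R) (e : rexpr) : R :=
  match e with
  | RLit n => n%:R
  | RGet a e1 e2 => reals s a (ieval s e1) (ieval s e2)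
  | RAdd e1 e2 => reval s e1 + reval s e2
  | RSub e1 e2 => reval s e1 - reval s e2
  | RMul e1 e2 => reval s e1 * reval s e2
  | RDiv e1 e2 => reval s e1 / reval s e2
  | RSqrt e1 => Num.sqrt (reval s e1)
  end.

Definition teval (R : realType) (s : state R) (t : test) : bool :=
  match t with
  | ILe e1 e2 => (ieval s e1 <= ieval s e2)%N
  | RLe e1 e2 => reval s e1 <= reval s e2
  end.

(* Every literal, memory access, arithmetic operation (on reals or on indices),
   comparison, assignment, branching and loop iteration costs one unit. *)
Fixpoint icost (e : iexpr) : nat :=
  match e with
  | ILit _ | IVar _ => 1
  | IGet _ e1 => (icost e1).+1
  | IAdd e1 e2 | ISub e1 e2 => (icost e1 + icost e2).+1
  end.

Fixpoint rcost (e : rexpr) : nat :=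
  match e with
  | RLit _ => 1
  | RGet _ e1 e2 => (icost e1 + icost e2).+1
  | RAdd e1 e2 | RSub e1 e2 | RMul e1 e2 | RDiv e1 e2 =>
      (rcost e1 + rcost e2).+1
  | RSqrt e1 => (rcost e1).+1
  end.

Definition tcost (t : test) : nat :=
  match t with
  | ILe e1 e2 => (icost e1 + icost e2).+1
  | RLe e1 e2 => (rcost e1 + rcost e2).+1
  end.

(* Final state and number of operations performed. *)
Fixpoint exec (R : realType) (c : cmd) (s : state R) : state R * nat :=
  match c with
  | Skip => (s, 0%N)
  | Seq c1 c2 =>
      let: (s1, t1) := exec c1 s in
      let: (s2, t2) := exec c2 s1 in
      (s2, (t1 + t2)%N)
  | SetVar x e => (set_var s x (ieval s e), (icost e).+1)
  | SetInt a e1 e2 =>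
      (set_int s a (ieval s e1) (ieval s e2), (icost e1 + icost e2).+1)
  | SetReal a e1 e2 e3 =>
      (set_real s a (ieval s e1) (ieval s e2) (reval s e3),
       (icost e1 + icost e2 + rcost e3).+1)
  | If t c1 c2 =>
      let: (s1, n) := if teval s t then exec c1 s else exec c2 s in
      (s1, (tcost t + n).+1)
  | For x e c1 =>
      iteri (ieval s e)
        (fun k (p : state R * nat) =>
           let: (s1, n) := exec c1 (set_var p.1 x k) in
           (s1, (p.2 + n).+1))
        (s, (icost e).+1)
  end.

(* An r x N matrix seen as an infinite array, 0 outside its index range. *)
Definition entries (R : realType) (r N : nat) (A : 'M[R]_(r, N)) (i j : nat) :
    R :=
  if insub i is Some i' then if insub j is Some j' then A i' j' else 0 else 0.

(* r and N are in variables 0 and 1, the real and imaginary parts of V in the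
   real arrays 0 and 1; everything else is 0. *)
Definition input (R : realType) (r N : nat) (V : 'M[R[i]]_(r, N)) : state R :=
  State (fun x => match x with 0%N => r | 1%N => N | _ => 0%N end)
        (fun _ _ => 0%N)
        (fun a => match a with
                  | 0%N => entries (map_mx (@complex.Re R) V)
                  | 1%N => entries (map_mx (@complex.Im R) V)
                  | _ => fun _ _ => 0
                  end).

(* The result is the list of column indices left in integer array 0. *)
Definition output (R : realType) (s : state R) (k : nat) : nat := ints s 0 k.

(* Main.v *)
Require Import Defs.
From mathcomp Require Import all_boot all_order all_algebra.
From mathcomp Require Import all_reals.
From mathcomp Require Import complex.
From mathcomp Require Import ring lra zify.
Import Order.TTheory GRing.Theory Num.Theory.
Local Open Scope ring_scope.

Set Implicit Arguments.
Unset Strict Implicit.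
Unset Printing Implicit Defensive.

(** Columns are picked greedily.  If T is the list of k columns chosen so far,
X its pseudo-inverse and P the orthogonal projector onto the complement of its
span, then adding a column v adds (1 + |X v|^2) / |P v|^2 to |X|_F^2, and the
algorithm takes the column minimizing this ratio.  Over all columns of V the
|P v|^2 sum to r - k and the |X v|^2 to |X|_F^2, because V V^* = 1, while a
column of T has P v = 0 and |X v| = 1.  Hence the minimal ratio is at most
(N + |X|_F^2 - 2k) / (r - k), so (r - k + 1) |X|_F^2 grows by at most N - 2k in
step k, and telescoping gives the Frobenius bound.  Since V is a contraction,
all singular values of the inverse are at least 1; the other r - 1 of them
therefore contribute at least r - 1 to the squared Frobenius norm, which yields
the spectral bound.  P V and X V change by rank one matrices, so each of the r
steps costs O(N r). *)

(** * Squared Frobenius norms, orthogonal projectors and the spectral bound *)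

Section Matrices.

Variable R : realType.
Local Notation C := R[i].
Local Notation rc := (real_complex R).

Lemma adjointM m n p (A : 'M[C]_(m, n)) (B : 'M[C]_(n, p)) :
  adjoint (A *m B) = adjoint B *m adjoint A.
Proof. by rewrite /adjoint trmx_mul map_mxM. Qed.

Lemma adjointK m n (A : 'M[C]_(m, n)) : adjoint (adjoint A) = A.
Proof. by apply/matrixP=> i j; rewrite !mxE conjCK. Qed.

Lemma adjoint1 n : adjoint 1%:M = 1%:M :> 'M[C]_n.
Proof. by rewrite /adjoint trmx1 map_mx1. Qed.

Lemma adjointB m n (A B : 'M[C]_(m, n)) : adjoint (A - B) = adjoint A - adjoint B.
Proof. by apply/matrixP=> i j; rewrite !mxE rmorphB. Qed.

Lemma adjointZ m n (a : R) (A : 'M[C]_(m, n)) :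
  adjoint (rc a *: A) = rc a *: adjoint A.
Proof. by apply/matrixP=> i j; rewrite !mxE rmorphM /= [X in X * _]conjc_real. Qed.

Definition nsq (z : C) : R := complex.Re z ^+ 2 + complex.Im z ^+ 2.

Lemma nsqE z : rc (nsq z) = z * Num.conj z.
Proof. by rewrite /nsq add_Re2_Im2 normCK. Qed.

Lemma nsq_ge0 z : 0 <= nsq z.
Proof. by rewrite addr_ge0 // sqr_ge0. Qed.

Definition fsq m n (A : 'M[C]_(m, n)) : R := \sum_i \sum_j nsq (A i j).

Lemma frobnormE m n (A : 'M[C]_(m, n)) : frobnorm A = Num.sqrt (fsq A).
Proof.
congr Num.sqrt; apply: eq_bigr => i _; apply: eq_bigr => j _.
by rewrite normc_def /= sqr_sqrtr // nsq_ge0.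
Qed.

Lemma fsq_ge0 m n (A : 'M[C]_(m, n)) : 0 <= fsq A.
Proof. by do 2!apply: sumr_ge0 => ? _; apply: nsq_ge0. Qed.

Lemma fsq0 m n : fsq (0 : 'M[C]_(m, n)) = 0.
Proof. by do 2!rewrite /fsq big1 // => ? _; rewrite mxE /nsq /= expr0n addr0. Qed.

Lemma fsq_eq0 m n (A : 'M[C]_(m, n)) : fsq A = 0 -> A = 0.
Proof.
move=> A0; apply/matrixP=> i j; rewrite mxE.
have /eqP := A0; rewrite psumr_eq0 => [/allP/(_ i)|k _]; last first.
  by apply: sumr_ge0 => ? _; apply: nsq_ge0.
rewrite mem_index_enum psumr_eq0 => [/(_ isT)/allP/(_ j)|k _]; last exact: nsq_ge0.
rewrite mem_index_enum => /(_ isT)/eqP /= N0.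
by apply/eqP; rewrite -normr_eq0 -sqrf_eq0 -add_Re2_Im2 -/(nsq _) N0.
Qed.

Lemma fsq_tr m n (A : 'M[C]_(m, n)) : rc (fsq A) = \tr (A *m adjoint A).
Proof.
rewrite /fsq rmorph_sum; apply: eq_bigr => i _.
rewrite mxE rmorph_sum; apply: eq_bigr => j _ /=.
by rewrite !mxE -nsqE.
Qed.

Lemma fsq_trC m n (A : 'M[C]_(m, n)) : rc (fsq A) = \tr (adjoint A *m A).
Proof. by rewrite fsq_tr mxtrace_mulC. Qed.

Lemma fsq_cols m n (A : 'M[C]_(m, n)) : fsq A = \sum_j fsq (col j A).
Proof.
rewrite /fsq exchange_big; apply: eq_bigr => j _; apply: eq_bigr => i _.
by rewrite big_ord1 mxE.
Qed.

Lemma fsqN m n (A : 'M[C]_(m, n)) : fsq (- A) = fsq A.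
Proof.
by do 2!apply: eq_bigr => ? _; rewrite mxE /nsq; case: (A _ _) => a b /=; rewrite !sqrrN.
Qed.

Lemma adj_mul_col n (w : 'cV[C]_n) : adjoint w *m w = (rc (fsq w))%:M.
Proof. by rewrite fsq_trC [LHS]mx11_scalar /mxtrace big_ord1. Qed.

Lemma fsq_isom m n p (A : 'M[C]_(m, n)) (V : 'M[C]_(n, p)) :
  V *m adjoint V = 1%:M -> fsq (A *m V) = fsq A.
Proof.
move=> VV; apply: (@complexI R).
by rewrite !fsq_tr adjointM mulmxA -(mulmxA A) VV mulmx1.
Qed.

Lemma fsq_coisom m n p (E : 'M[C]_(m, n)) (A : 'M[C]_(n, p)) :
  adjoint E *m E = 1%:M -> fsq (E *m A) = fsq A.
Proof.
move=> EE; apply: (@complexI R).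
by rewrite !fsq_trC adjointM mulmxA -(mulmxA _ _ E) EE mulmx1.
Qed.

(** [adjoint V *m V] is an orthogonal projector, so by Pythagoras the loss of norm is the squared
    norm of the component it removes from [A]. *)
Lemma fsq_contract m n p (V : 'M[C]_(m, n)) (A : 'M[C]_(n, p)) :
  V *m adjoint V = 1%:M -> fsq (V *m A) <= fsq A.
Proof.
move=> VV; rewrite -subr_ge0.
suff -> : fsq A - fsq (V *m A) = fsq (A - adjoint V *m (V *m A)).
  exact: fsq_ge0.
apply: (@complexI R); rewrite rmorphB /= !fsq_trC.
rewrite adjointB !adjointM adjointK !(mulmxBl, mulmxBr).
have -> : adjoint A *m adjoint V *m V *m (adjoint V *m (V *m A))
  = adjoint A *m adjoint V *m (V *m A).
  by rewrite !mulmxA -(mulmxA _ V (adjoint V)) VV mulmx1.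
rewrite !mulmxA; move: (adjoint A *m A) (_ *m A) => M N.
by rewrite subrr subr0 [RHS]raddfB.
Qed.

Lemma rcVK (a : R) : a != 0 -> rc a^-1 * rc a = 1.
Proof. by move=> a0; rewrite -[LHS]rmorphM mulVf. Qed.

(** Since [X *m w = 0], the rows of [X] are orthogonal to those of the correction and the cross
    terms vanish. *)
Lemma fsq_rank1 m n (X : 'M[C]_(m, n)) (d : 'cV_m) (w : 'cV_n) :
  fsq w != 0 -> X *m w = 0 ->
  fsq (X - rc (fsq w)^-1 *: (d *m adjoint w)) = fsq X + fsq d / fsq w.
Proof.
move=> w0 Xw; apply: (@complexI R); rewrite rmorphD /= !fsq_tr.
rewrite adjointB adjointZ adjointM adjointK !(mulmxBl, mulmxBr).
have wX : adjoint w *m adjoint X = 0.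
  by rewrite -adjointM Xw; apply/matrixP=> i j; rewrite !mxE conjC0.
rewrite -!(scalemxAl, scalemxAr) !mulmxA Xw mul0mx -(mulmxA d) wX mulmx0 !scaler0.
rewrite -(mulmxA d) adj_mul_col mul_mx_scalar -scalemxAl scalerA !subr0 sub0r opprK.
rewrite rcVK // scale1r raddfD /= mxtraceZ -fsq_tr mulrC -fsq_tr.
by rewrite -[_ * _]rmorphM.
Qed.

(** As [w] lies in the range of [P], subtracting the projector onto [w] leaves a projector; its
    trace counts the remaining dimension. *)
Lemma proj_deflate n (P : 'M[C]_n) (w : 'cV_n) (P' := P - rc (fsq w)^-1 *: (w *m adjoint w)) :
  adjoint P = P -> P *m P = P -> P *m w = w -> fsq w != 0 ->
  [/\ adjoint P' = P', P' *m P' = P', \tr P' = \tr P - 1 & P' *m w = 0].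
Proof.
move=> aP PP Pw w0.
have P'w : P' *m w = 0.
  rewrite mulmxBl Pw -scalemxAl -mulmxA adj_mul_col mul_mx_scalar scalerA.
  by rewrite rcVK // scale1r subrr.
split => //.
- by rewrite adjointB adjointZ adjointM adjointK aP.
- have P'P : P' *m P = P'.
    have wP : adjoint w *m P = adjoint w by rewrite -{1}aP -adjointM Pw.
    by rewrite mulmxBl PP -scalemxAl -mulmxA wP.
  by rewrite {2}/P' mulmxBr P'P -scalemxAr mulmxA P'w mul0mx scaler0 subr0.
- rewrite raddfB /= mxtraceZ mxtrace_mulC adj_mul_col mxtrace_scalar mulr1n.
  by rewrite rcVK.
Qed.

Lemma fsq_proj n (P : 'M[C]_n) : adjoint P = P -> P *m P = P -> rc (fsq P) = \tr P.
Proof. by move=> aP PP; rewrite fsq_tr aP PP. Qed.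

(** [E] is meant to be a column selector, so that [V *m E] is the submatrix and [Y] its inverse. The
    term [m%:R - 1] is the share of [fsq Y] that the directions orthogonal to a given [x] always
    take. *)
Lemma specnorm_le m n p (V : 'M[C]_(m, n)) (E : 'M[C]_(n, p))
    (Y : 'M[C]_(p, m)) (b : R) :
  V *m adjoint V = 1%:M -> adjoint E *m E = 1%:M ->
  V *m E *m Y = 1%:M -> fsq Y <= b + (m%:R - 1) -> 0 <= b ->
  specnorm Y <= Num.sqrt b.
Proof.
move=> VV EE VEY Yb b0; apply: ge_sup.
  exists (frobnorm (Y *m (0 : 'cV_m))); exists 0 => //.
  suff -> : frobnorm (0 : 'cV[C]_m) = 0 by [].
  by rewrite frobnormE fsq0 sqrtr0.
move=> _ [x + ->]; rewrite !frobnormE -{1}sqrtr1 ler_sqrt // => x1.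
rewrite ler_sqrt //.
have [/fsq_eq0->|x0] := eqVneq (fsq x) 0.
  by rewrite mulmx0 fsq0.
(* Q is the projector onto the complement of x, so that
     |Y|_F^2 = |Y x|^2 / |x|^2 + |Y Q|_F^2 and |Y Q|_F^2 >= |Q|_F^2 = m - 1. *)
have [aQ QQ trQ Qx] := proj_deflate (adjoint1 m) (mulmx1 _) (mul1mx x) x0.
set Q := 1%:M - _ in aQ QQ trQ Qx.
have YQ : Y = Y *m Q - rc (fsq x)^-1 *: (- (Y *m x) *m adjoint x).
  by rewrite mulNmx scalerN opprK mulmxBr mulmx1 -scalemxAr mulmxA subrK.
have YQx : Y *m Q *m x = 0 by rewrite -mulmxA Qx mulmx0.
have : fsq Y = fsq (Y *m Q) + fsq (Y *m x) / fsq x.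
  by rewrite {1}YQ fsq_rank1 // fsqN.
have : m%:R - 1 <= fsq (Y *m Q).
  have -> : m%:R - 1 = fsq Q.
    by apply: (@complexI R); rewrite fsq_proj // trQ mxtrace1 rmorphB rmorph_nat.
  have <- : fsq (V *m (E *m (Y *m Q))) = fsq Q by rewrite !mulmxA VEY mul1mx.
  by rewrite (le_trans (fsq_contract _ VV)) // fsq_coisom.
have x_gt0 : 0 < fsq x by rewrite lt_def x0 fsq_ge0.
have : fsq (Y *m x) <= fsq (Y *m x) / fsq x.
  by rewrite ler_pdivlMr // ler_piMr // fsq_ge0.
lra.
Qed.

End Matrices.

(** * The greedy step: a good column exists, and [P] and [X] are updated *)

Section Greedy.

Variables (R : realType) (r N : nat) (V : 'M[R[i]]_(r, N)).
Hypothesis VV : V *m adjoint V = 1%:M.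
Local Notation C := R[i].
Local Notation rc := (real_complex R).

(* The columns f 0, ..., f (k - 1) of V are chosen, P is the projector onto the
   complement of their span and X their pseudo-inverse, padded with zero rows;
   the values of f from k on are irrelevant. *)
Structure selected (k : nat) (P X : 'M[C]_r) (f : 'I_r -> 'I_N) : Prop := Selected {
  sel_adj : adjoint P = P;
  sel_idem : P *m P = P;
  sel_XP : X *m P = 0;
  sel_tr : \tr P = rc (r%:R - k%:R);
  sel_X0 : forall l j : 'I_r, (k <= l)%N -> X l j = 0;
  sel_Xf : forall l : 'I_r, (l < k)%N -> X *m col (f l) V = delta_mx l 0;
  sel_Pf : forall l : 'I_r, (l < k)%N -> P *m col (f l) V = 0;
  sel_bound : (r%:R - k%:R + 1) * fsq X <= k%:R * (N%:R - k%:R + 1)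
}.

Lemma selected0 f : selected 0 1%:M 0 f.
Proof.
split=> //.
- exact: adjoint1.
- by rewrite mulmx1.
- by rewrite mul0mx.
- by rewrite mxtrace1 subr0 rmorph_nat.
- by move=> l j _; rewrite mxE.
- by rewrite fsq0 mulr0 mul0r.
Qed.

Lemma selected_inv P X f : selected r P X f -> X *m colsub f V = 1%:M.
Proof.
move=> S; rewrite mulmx_colsub; apply/matrixP=> i j; rewrite !mxE.
have := sel_Xf S (ltn_ord j) => /matrixP/(_ i 0); rewrite !mxE eqxx andbT => <-.
by apply: eq_bigr => l _; rewrite mxE.
Qed.

(** This is the source of the 1 in the ratio: row [k] of [X] is still zero when the new unit vector
    enters. *)
Lemma fsq_delta n (u : 'cV[C]_n) k : u k 0 = 0 -> fsq (u - delta_mx k 0) = fsq u + 1.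
Proof.
move=> uk; rewrite /fsq (bigD1 k) //= [in RHS](bigD1 k) //= !big_ord1 !mxE !eqxx uk.
rewrite (eq_bigr (fun l => \sum_j nsq (u l j))) => [|l lk].
  by rewrite /nsq /=; ring.
by rewrite !big_ord1 !mxE (negPf lk) subr0.
Qed.

(** Right multiplication by [V] preserves the norm because [V *m adjoint V = 1%:M]; applied to [P]
    and [X], this gives the averages over all columns. *)
Lemma sum_fsq_col (A : 'M[C]_r) : \sum_j fsq (A *m col j V) = fsq A.
Proof.
rewrite -(fsq_isom A VV) [RHS]fsq_cols; apply: eq_bigr => j _.
by rewrite !colE mulmxA.
Qed.

(** The hypothesis maximizes the inverse of the ratio to be minimized, which remains meaningful on
    columns with [P v = 0]. Cross-multiplied, it can be summed over all columns. *)
Lemma greedy_average (k : 'I_r) P X f i : selected k P X f ->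
  (forall j, fsq (P *m col j V) / (1 + fsq (X *m col j V)) <=
             fsq (P *m col i V) / (1 + fsq (X *m col i V))) ->
  fsq (P *m col i V) != 0 /\
  (r%:R - k%:R) * ((fsq (X *m col i V) + 1) / fsq (P *m col i V))
    <= N%:R + fsq X - 2 * k%:R.
Proof.
move=> S; set b := fun j => fsq (P *m col j V); set c := fun j => fsq (X *m col j V).
rewrite -/(b i) -/(c i) => qi.
have b0 j : 0 <= b j by apply: fsq_ge0.
have c0 j : 0 <= c j by apply: fsq_ge0.
have bc j : b j * (1 + c i) <= b i * (1 + c j).
  have := qi j; rewrite -/(b j) -/(c j) ler_pdivrMr ?ltr_pwDl //.
  by rewrite mulrAC ler_pdivlMr ?ltr_pwDl.
have sb : \sum_j b j = r%:R - k%:R.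
  rewrite sum_fsq_col; apply: (@complexI R).
  by rewrite fsq_proj ?(sel_tr S) // ?(sel_adj S) ?(sel_idem S).
have sc : \sum_j c j = fsq X by apply: sum_fsq_col.
have kr : (0 : R) < r%:R - k%:R by rewrite subr_gt0 ltr_nat.
(* If the best ratio were 0, every [b j] would vanish, although they sum to r - k > 0. *)
have bi0 : b i != 0.
  apply/eqP=> bi; move: kr; rewrite -sb big1 ?ltxx // => j _.
  apply/eqP; rewrite eq_le b0 andbT.
  by have := bc j; rewrite bi mul0r pmulr_lle0 // ltr_pwDl.
split=> //.
pose T := [set f l | l : 'I_r & (l < k)%N].
(* The chosen columns are distinct, since [X] sends them to distinct unit vectors. *)
have cT : #|T| = k.
  rewrite card_in_imset => [|l l']; last first.
    rewrite !inE => lk lk' ff.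
    have := sel_Xf S lk'; rewrite -ff (sel_Xf S lk) => /matrixP/(_ l 0).
    rewrite !mxE !eqxx andbT; case: eqP => // _ /eqP.
    by rewrite oner_eq0.
  by rewrite -sum1dep_card (big_ord_narrow (ltnW (ltn_ord k))) sum1_card card_ord.
(* A chosen column has [b j = 0] and [c j = 1], which leaves a slack of [2 * b i]; over the k chosen
   columns this produces the term -2k. *)
have bcT j : b j * (1 + c i) + (if j \in T then 2 * b i else 0) <= b i * (1 + c j).
  case: ifP => [/imsetP[l] | _]; last by rewrite addr0.
  rewrite inE => lk ->; rewrite /b /c (sel_Pf S lk) (sel_Xf S lk).
  rewrite fsq0 mul0r add0r mulrC.
  have -> : fsq (delta_mx l 0 : 'cV[C]_r) = 1.
    by rewrite -fsqN -[- _]add0r fsq_delta ?mxE // fsq0 add0r.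
  by [].
have : \sum_j (b j * (1 + c i) + (if j \in T then 2 * b i else 0))
    <= \sum_j b i * (1 + c j) by apply: ler_sum => j _; apply: bcT.
rewrite big_split /= -mulr_suml sb -big_mkcond /= sumr_const cT.
rewrite -mulr_sumr big_split /= sc sumr_const card_ord -mulr_natr.
have bi : 0 < b i by rewrite lt_def bi0 b0.
rewrite mulrA ler_pdivrMr //; lra.
Qed.

(** The adjoint of [w] annihilates the columns already chosen, so their images do not change; on the
    new column it equals |w|^2, so the corrections subtract exactly [w] and [d], leaving 0 and the
    unit vector at [k]. *)
Lemma selectedS (k : 'I_r) P X f i : selected k P X f ->
  (forall j, fsq (P *m col j V) / (1 + fsq (X *m col j V)) <=
             fsq (P *m col i V) / (1 + fsq (X *m col i V))) ->
  let w := P *m col i V in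
  let d : 'cV_r := X *m col i V - delta_mx k 0 in
  selected k.+1 (P - rc (fsq w)^-1 *: (w *m adjoint w))
    (X - rc (fsq w)^-1 *: (d *m adjoint w)) (fun l => if l == k then i else f l).
Proof.
move=> S qi w d; have [w0 avg] := greedy_average S qi.
rewrite -/w in w0 avg.
have Pw : P *m w = w by rewrite mulmxA (sel_idem S).
have Xw : X *m w = 0 by rewrite mulmxA (sel_XP S) mul0mx.
have [aP' PP' trP' P'w] := proj_deflate (sel_adj S) (sel_idem S) Pw w0.
have wP : adjoint w *m P = adjoint w by rewrite -{1}(sel_adj S) -adjointM Pw.
have wi : adjoint w *m col i V = (rc (fsq w))%:M.
  by rewrite -wP -mulmxA adj_mul_col.
have wf (l : 'I_r) : (l < k)%N -> adjoint w *m col (f l) V = 0.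
  by move=> lk; rewrite -wP -mulmxA (sel_Pf S lk) mulmx0.
have scal m (u : 'cV[C]_m) : rc (fsq w)^-1 *: (u *m adjoint w) *m col i V = u.
  by rewrite -scalemxAl -mulmxA wi mul_mx_scalar scalerA rcVK // scale1r.
have scal0 m (u : 'cV[C]_m) (l : 'I_r) : (l < k)%N ->
    rc (fsq w)^-1 *: (u *m adjoint w) *m col (f l) V = 0.
  by move=> lk; rewrite -scalemxAl -mulmxA wf // mulmx0 scaler0.
have kS (l : 'I_r) : (l < k.+1)%N -> l != k -> (l < k)%N.
  by rewrite ltnS leq_eqVlt => /orP[/eqP/ord_inj->|//]; rewrite eqxx.
split=> //.
- set P' := P - _ in aP' P'w *.
  have wP' : adjoint w *m P' = 0.
    by rewrite -aP' -adjointM P'w; apply/matrixP=> ? ?; rewrite !mxE conjC0.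
  rewrite mulmxBl -scalemxAl -mulmxA wP' mulmx0 scaler0 subr0.
  by rewrite mulmxBr (sel_XP S) -scalemxAr mulmxA Xw mul0mx scaler0 subr0.
- rewrite trP' (sel_tr S) -(rmorph1 rc) -[LHS]rmorphB /=; congr (rc _).
  by rewrite -natr1; ring.
- move=> l j lk; rewrite !mxE big_ord1 !mxE (sel_X0 S) ?(ltnW lk) //.
  rewrite big1 => [|j' _]; last by rewrite (sel_X0 S) ?mul0r // ltnW.
  have -> : (l == k) = false by apply/negbTE/eqP => lk'; rewrite lk' ltnn in lk.
  by rewrite !subr0 mul0r mulr0 subr0.
- move=> l lk; case: eqP => [-> | /eqP lk'].
    by rewrite mulmxBl scal /d opprB addrC subrK.
  by rewrite mulmxBl scal0 ?subr0 ?(sel_Xf S) // kS.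
- move=> l lk; case: eqP => [_ | /eqP lk'].
    by rewrite mulmxBl scal subrr.
  by rewrite mulmxBl scal0 ?subr0 ?(sel_Pf S) // kS.
(* By the averaging estimate the left side grows by at most N - 2k, and k(N - k + 1) + N - 2k = (k +
   1)(N - k). *)
- rewrite fsq_rank1 // fsq_delta; last first.
    by rewrite mxE big1 // => j _; rewrite (sel_X0 S) ?mul0r.
  have := sel_bound S; rewrite -natr1; move: avg; lra.
Qed.

End Greedy.

(** * Write sets of commands, the frame property and loop invariants *)

Fixpoint wvars (c : cmd) : seq nat :=
  match c with
  | Seq c1 c2 | If _ c1 c2 => wvars c1 ++ wvars c2
  | SetVar x _ => [:: x]
  | For x _ c1 => x :: wvars c1
  | _ => [::]
  end.

Fixpoint wints (c : cmd) : seq nat :=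
  match c with
  | Seq c1 c2 | If _ c1 c2 => wints c1 ++ wints c2
  | SetInt a _ _ => [:: a]
  | For _ _ c1 => wints c1
  | _ => [::]
  end.

Fixpoint wreals (c : cmd) : seq nat :=
  match c with
  | Seq c1 c2 | If _ c1 c2 => wreals c1 ++ wreals c2
  | SetReal a _ _ _ => [:: a]
  | For _ _ c1 => wreals c1
  | _ => [::]
  end.

Section Semantics.

Variable R : realType.
Implicit Types (s : state R) (c : cmd).

Definition run c s : state R := (exec c s).1.

Lemma run_seq c1 c2 s : run (Seq c1 c2) s = run c2 (run c1 s).
Proof. by rewrite /run /=; case: (exec c1 s) => s1 t1 /=; case: (exec c2 s1). Qed.

Lemma run_if t c1 c2 s : run (If t c1 c2) s = if teval s t then run c1 s else run c2 s.
Proof. by rewrite /run /=; case: (teval s t) => /=; case: (exec _ s). Qed.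

Lemma run_for x e c s :
  run (For x e c) s = iteri (ieval s e) (fun k s' => run c (set_var s' x k)) s.
Proof.
rewrite /run /=; elim: (ieval s e) => //= n <-.
by case: (iteri _ _ _) => s1 t1 /=; case: (exec c _).
Qed.

Record agree c s s' : Prop := Agree {
  agree_vars : forall x, x \notin wvars c -> vars s' x = vars s x;
  agree_ints : forall a, a \notin wints c -> ints s' a = ints s a;
  agree_reals : forall a, a \notin wreals c -> reals s' a = reals s a
}.

Lemma run_agree c s : agree c s (run c s).
Proof.
elim: c s => /= [|c1 IH1 c2 IH2|x e|a e1 e2|a e1 e2 e3|t c1 IH1 c2 IH2|x e c IH] s.
- by split.
- rewrite run_seq; have [v1 i1 r1] := IH1 s; have [v2 i2 r2] := IH2 (run c1 s).
  split=> a; rewrite /= mem_cat negb_or => /andP[h1 h2].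
  + by rewrite v2 ?v1.
  + by rewrite i2 ?i1.
  + by rewrite r2 ?r1.
- by split=> // y; rewrite /= inE => /negPf ->.
- by split=> // y; rewrite /= inE => /negPf ->.
- by split=> // y; rewrite /= inE => /negPf ->.
- rewrite run_if; have [v1 i1 r1] := IH1 s; have [v2 i2 r2] := IH2 s.
  split=> a; rewrite /= mem_cat negb_or => /andP[h1 h2]; case: ifP => _.
  + by rewrite v1. + by rewrite v2.
  + by rewrite i1. + by rewrite i2.
  + by rewrite r1. + by rewrite r2.
- rewrite run_for; elim: (ieval s e) => [|n [v1 i1 r1]] /=; first by split.
  set s1 := iteri n _ s in v1 i1 r1 *; have [v2 i2 r2] := IH (set_var s1 x n).
  split=> a /= ha.
  + move: (ha); rewrite inE negb_or => /andP[h1 h2].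
    by rewrite v2 //= (negPf h1) v1.
  + by rewrite i2 //= i1.
  + by rewrite r2 //= r1.
Qed.

(** The inductive step also receives [agree] with the state before the loop, so an invariant needs
    to mention only what the body modifies. *)
Lemma run_for_ind (I : nat -> state R -> Prop) x e c s :
  I 0%N s ->
  (forall k s', (k < ieval s e)%N -> agree (For x e c) s s' -> I k s' ->
     I k.+1 (run c (set_var s' x k))) ->
  I (ieval s e) (run (For x e c) s).
Proof.
move=> I0 IS; rewrite run_for.
suff h n : (n <= ieval s e)%N ->
  I n (iteri n (fun k s' => run c (set_var s' x k)) s) by apply: h.
elim: n => //= n IHn lt_n; apply: IS => //; last exact/IHn/ltnW.
(* The first n iterations are themselves a run of the loop with literal bound n, which has the same
   write sets. *)
by have := run_agree (For x (ILit n) c) s; rewrite run_for => -[].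
Qed.

(** * Static bound on the running time *)

Fixpoint ibound (v : nat -> nat) (e : iexpr) : nat :=
  match e with
  | ILit n => n
  | IVar x => v x
  | IGet _ _ => 0
  | IAdd e1 e2 => ibound v e1 + ibound v e2
  | ISub e1 e2 => ibound v e1 - ibound v e2
  end.

(* An upper bound on the running time, valid if the loop bounds depend only on
   variables that are never assigned; v gives the values of these. *)
Fixpoint cost (v : nat -> nat) (c : cmd) : nat :=
  match c with
  | Skip => 0
  | Seq c1 c2 => cost v c1 + cost v c2
  | SetVar _ e => (icost e).+1
  | SetInt _ e1 e2 => (icost e1 + icost e2).+1
  | SetReal _ e1 e2 e3 => (icost e1 + icost e2 + rcost e3).+1
  | If t c1 c2 => (tcost t + maxn (cost v c1) (cost v c2)).+1
  | For _ e c1 => (icost e).+1 + ibound v e * (cost v c1).+1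
  end.

(** Array reads are excluded; the 0 that [ibound] assigns to them is a dummy value. *)
Fixpoint istatic (fixed : seq nat) (e : iexpr) : bool :=
  match e with
  | ILit _ => true
  | IVar x => x \in fixed
  | IGet _ _ => false
  | IAdd e1 e2 | ISub e1 e2 => istatic fixed e1 && istatic fixed e2
  end.

Fixpoint static (fixed : seq nat) (c : cmd) : bool :=
  match c with
  | Seq c1 c2 | If _ c1 c2 => static fixed c1 && static fixed c2
  | For _ e c1 => istatic fixed e && static fixed c1
  | _ => true
  end.

Lemma ieval_static fixed v s e :
  {in fixed, vars s =1 v} -> istatic fixed e -> ieval s e = ibound v e.
Proof.
move=> sv; elim: e => //= e1 IH1 e2 IH2; by move=> /andP[/IH1-> /IH2->].
Qed.

(** By the frame property the fixed variables keep their values throughout, so every loop bound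
    evaluates to its [ibound]. *)
Lemma exec_cost fixed v c s :
  static fixed c -> all (fun x => x \notin wvars c) fixed -> {in fixed, vars s =1 v} ->
  ((exec c s).2 <= cost v c)%N.
Proof.
move=> + /allP; elim: c s => //=
  [c1 IH1 c2 IH2|t c1 IH1 c2 IH2|x e c IH] s /andP[h1 h2] fx sv.
- have fx1 : {in fixed, forall x, x \notin wvars c1}.
    by move=> x /fx; rewrite mem_cat negb_or => /andP[].
  have fx2 : {in fixed, forall x, x \notin wvars c2}.
    by move=> x /fx; rewrite mem_cat negb_or => /andP[].
  have := IH1 s h1 fx1 sv; have /= := agree_vars (run_agree c1 s).
  rewrite /run; case: (exec c1 s) => s1 t1 /= sv1.
  have sv1' : {in fixed, vars s1 =1 v} by move=> x xf; rewrite sv1 ?sv ?fx1.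
  have := IH2 s1 h2 fx2 sv1'; case: (exec c2 s1) => s2 t2 /=; lia.
- have fx1 : {in fixed, forall x, x \notin wvars c1}.
    by move=> x /fx; rewrite mem_cat negb_or => /andP[].
  have fx2 : {in fixed, forall x, x \notin wvars c2}.
    by move=> x /fx; rewrite mem_cat negb_or => /andP[].
  have := IH1 s h1 fx1 sv; have := IH2 s h2 fx2 sv.
  case: (teval s t); first by case: (exec c1 s) => s1 t1 /=; lia.
  by case: (exec c2 s) => s2 t2 /=; lia.
- rewrite (ieval_static sv h1).
  have fxc : {in fixed, forall x, x \notin wvars c}.
    by move=> y /fx; rewrite inE negb_or => /andP[].
  set f := fun k p => _.
  have h n : {in fixed, vars (iteri n f (s, (icost e).+1)).1 =1 v} /\
      ((iteri n f (s, (icost e).+1)).2 <= (icost e).+1 + n * (cost v c).+1)%N.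
    elim: n => [|n [sn tn]]; first by rewrite mul0n addn0.
    rewrite iteriS /f; case: (iteri n _ _) sn tn => s1 t1 /= sn tn.
    have s1v : {in fixed, vars (set_var s1 x n) =1 v}.
      by move=> y yf /=; case: eqP (fx _ yf) => [->|_ _]; rewrite ?inE ?eqxx ?sn.
    have := IH _ h2 fxc s1v; have := agree_vars (run_agree c (set_var s1 x n)).
    rewrite /run; case: (exec c _) => s2 t2 /= sv2 t2c; split; last by lia.
    by move=> y yf; rewrite sv2 ?fxc // -(s1v _ yf).
  by case: (h (ibound v e)).
Qed.

End Semantics.

(* Memory layout of the program.  Arrays come in pairs holding real and imaginary
   parts.  0, 1: the 2r x N matrix with P V on top of X V (the lower half is
   initially out of range of the input, hence 0).  2, 3: column p of that
   matrix, p being the pivot, minus the unit vector at r + k.  4, 5: the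
   coefficient of that column to be subtracted from column j.  The real cells
   6, 7, 8, 9 hold the best ratio |P v|^2 / (1 + |X v|^2) so far,
   1 + |X v|^2 and |P v|^2 for column j, and |P v|^2 for the pivot.
   Variables 2, 3, 4, 5 are k, j, the row index and p. *)
Definition get_cell (a : nat) : rexpr := RGet a (ILit 0) (ILit 0).
Definition set_cell (a : nat) (e : rexpr) : cmd := SetReal a (ILit 0) (ILit 0) e.
Definition rsq (e : rexpr) : rexpr := RMul e e.

Definition norms : cmd :=
  Seq (set_cell 8 (RLit 0)) (Seq (set_cell 7 (RLit 1))
  (For 4 (IVar 0)
    (Seq (set_cell 8 (RAdd (get_cell 8)
           (RAdd (rsq (RGet 0 (IVar 4) (IVar 3))) (rsq (RGet 1 (IVar 4) (IVar 3))))))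
         (set_cell 7 (RAdd (get_cell 7)
           (RAdd (rsq (RGet 0 (IAdd (IVar 0) (IVar 4)) (IVar 3)))
                 (rsq (RGet 1 (IAdd (IVar 0) (IVar 4)) (IVar 3))))))))).

(** The best ratio starts at 0 and the test is not strict, so the first column is always accepted
    and a pivot is always set. *)
Definition pivot : cmd :=
  Seq (set_cell 6 (RLit 0))
  (For 3 (IVar 1)
    (Seq norms
    (If (RLe (get_cell 6) (RDiv (get_cell 8) (get_cell 7)))
       (Seq (set_cell 6 (RDiv (get_cell 8) (get_cell 7)))
       (Seq (set_cell 9 (get_cell 8)) (SetVar 5 (IVar 3))))
       Skip))).

(** The copy is needed because [eliminate] overwrites the pivot column. It ends up holding w on top
    of d, the left factors of the two rank one updates. *)
Definition save : cmd :=
  Seq (For 4 (IAdd (IVar 0) (IVar 0))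
        (Seq (SetReal 2 (IVar 4) (ILit 0) (RGet 0 (IVar 4) (IVar 5)))
             (SetReal 3 (IVar 4) (ILit 0) (RGet 1 (IVar 4) (IVar 5)))))
      (SetReal 2 (IAdd (IVar 0) (IVar 2)) (ILit 0)
        (RSub (RGet 2 (IAdd (IVar 0) (IVar 2)) (ILit 0)) (RLit 1))).

(** Only the upper half is read: w^* P = w^*, so w^* (P v) = w^* v, and one coefficient serves both
    halves. *)
Definition alpha : cmd :=
  Seq (set_cell 4 (RLit 0)) (Seq (set_cell 5 (RLit 0))
  (Seq
  (For 4 (IVar 0)
    (Seq (set_cell 4 (RAdd (get_cell 4)
           (RAdd (RMul (RGet 2 (IVar 4) (ILit 0)) (RGet 0 (IVar 4) (IVar 3)))
                 (RMul (RGet 3 (IVar 4) (ILit 0)) (RGet 1 (IVar 4) (IVar 3))))))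
         (set_cell 5 (RAdd (get_cell 5)
           (RSub (RMul (RGet 2 (IVar 4) (ILit 0)) (RGet 1 (IVar 4) (IVar 3)))
                 (RMul (RGet 3 (IVar 4) (ILit 0)) (RGet 0 (IVar 4) (IVar 3))))))))
  (Seq (set_cell 4 (RDiv (get_cell 4) (get_cell 9)))
       (set_cell 5 (RDiv (get_cell 5) (get_cell 9)))))).

Definition update : cmd :=
  For 4 (IAdd (IVar 0) (IVar 0))
    (Seq (SetReal 0 (IVar 4) (IVar 3)
           (RSub (RGet 0 (IVar 4) (IVar 3))
             (RSub (RMul (RGet 2 (IVar 4) (ILit 0)) (get_cell 4))
                   (RMul (RGet 3 (IVar 4) (ILit 0)) (get_cell 5)))))
         (SetReal 1 (IVar 4) (IVar 3)
           (RSub (RGet 1 (IVar 4) (IVar 3))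
             (RAdd (RMul (RGet 2 (IVar 4) (ILit 0)) (get_cell 5))
                   (RMul (RGet 3 (IVar 4) (ILit 0)) (get_cell 4)))))).

Definition eliminate : cmd := For 3 (IVar 1) (Seq alpha update).

Definition step : cmd :=
  Seq pivot (Seq save (Seq eliminate (SetInt 0 (IVar 2) (IVar 5)))).

Definition prog : cmd := For 2 (IVar 0) step.

(** * Effect of the program fragments on the stored complex arrays *)

Section Program.

Variable R : realType.
Implicit Types (s : state R).
Local Notation C := R[i].

(* The complex array stored in the real arrays a and a + 1. *)
Definition carr s a (i j : nat) : C := Complex (reals s a i j) (reals s a.+1 i j).

Definition wnorm s j : R := \sum_(l < vars s 0) nsq (carr s 0 l j).
Definition cnorm s j : R := 1 + \sum_(l < vars s 0) nsq (carr s 0 (vars s 0 + l) j).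

Lemma run_norms s :
  reals (run norms s) 8 0 0 = wnorm s (vars s 3) /\
  reals (run norms s) 7 0 0 = cnorm s (vars s 3).
Proof.
rewrite /norms !run_seq; set s1 := run _ (run _ s).
have -> : wnorm s (vars s 3) = \sum_(l < ieval s1 (IVar 0)) nsq (carr s1 0 l (vars s1 3)).
  by [].
have -> : cnorm s (vars s 3) = 1 + \sum_(l < ieval s1 (IVar 0))
   nsq (carr s1 0 (vars s1 0 + l) (vars s1 3)) by [].
set c := Seq _ _.
pose I m s' := reals s' 8 0 0 = \sum_(l < m) nsq (carr s1 0 l (vars s1 3)) /\
  reals s' 7 0 0 = 1 + \sum_(l < m) nsq (carr s1 0 (vars s1 0 + l) (vars s1 3)).
apply: (@run_for_ind _ I); first by rewrite /I !big_ord0 addr0.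
move=> k s' _ [v _ rs] [I8 I7]; rewrite /I /nsq /carr /= !big_ord_recr /= I8 I7 /nsq /carr /=.
have [-> -> -> ->] : [/\ vars s' 0 = vars s 0, vars s' 3 = vars s 3,
  reals s' 0 = reals s 0 & reals s' 1 = reals s 1] by rewrite !v ?rs.
by split; rewrite -?addrA -!expr2 // addrA.
Qed.

Lemma wnorm_ge0 s j : 0 <= wnorm s j.
Proof. by apply: sumr_ge0 => l _; apply: nsq_ge0. Qed.

Lemma cnorm_gt0 s j : 0 < cnorm s j.
Proof. by rewrite ltr_pwDl // sumr_ge0 // => l _; apply: nsq_ge0. Qed.

Lemma run_pivot s : (0 < vars s 1)%N ->
  exists2 p, (p < vars s 1)%N &
    [/\ vars (run pivot s) 5 = p, reals (run pivot s) 9 0 0 = wnorm s p &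
        forall j, (j < vars s 1)%N -> wnorm s j / cnorm s j <= wnorm s p / cnorm s p].
Proof.
move=> N_gt0; rewrite /pivot run_seq; set s1 := run _ s.
pose I m s' := [/\ forall j, (j < m)%N -> wnorm s j / cnorm s j <= reals s' 6 0 0,
  m = 0%N -> reals s' 6 0 0 = 0 &
  (0 < m)%N -> exists2 p, (p < m)%N & [/\ vars s' 5 = p,
    reals s' 9 0 0 = wnorm s p & reals s' 6 0 0 = wnorm s p / cnorm s p]].
set c := Seq norms _.
have [|k s' kN [v _ rs] [Iq I0 Ip]|Iq _ /(_ N_gt0)[p pN [v5 r9 r6]]] :=
  @run_for_ind _ I 3 (IVar 1) c s1; first by split.
- rewrite /c run_seq run_if.
  have [n8 n7] := run_norms (set_var s' 3 k).
  have [nv _ nr] := run_agree norms (set_var s' 3 k).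
  set t := run norms _ in n8 n7 nv nr *.
  have v0 : vars s' 0 = vars s 0 by rewrite v.
  have r0 : reals s' 0 = reals s 0 by rewrite rs.
  have r1 : reals s' 1 = reals s 1 by rewrite rs.
  have {}n8 : reals t 8 0 0 = wnorm s k by rewrite n8 /wnorm /carr /= v0 r0 r1.
  have {}n7 : reals t 7 0 0 = cnorm s k by rewrite n7 /cnorm /carr /= v0 r0 r1.
  have t3 : vars t 3 = k by rewrite nv.
  have t6 : reals t 6 = reals s' 6 by rewrite nr.
  have t9 : reals t 9 = reals s' 9 by rewrite nr.
  have t5 : vars t 5 = vars s' 5 by rewrite nv.
  rewrite /= n8 n7 t6; case: leP => [le_q|lt_q]; split=> //=.
  + move=> j; rewrite n8 n7 ltnS leq_eqVlt => /orP[/eqP->//|jk].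
    exact: le_trans (Iq j jk) le_q.
  + by move=> _; exists k; rewrite // n8 n7 t3.
  + move=> j; rewrite t6 ltnS leq_eqVlt => /orP[/eqP->|/Iq//].
    exact: ltW.
  (* For [k = 0] rejection is impossible, because the ratio is nonnegative. *)
  + move=> _; case: (posnP k) Ip => [k0|k_gt0 /(_ isT)[p pk [p5 p9 p6]]].
      move: lt_q; rewrite I0 // ltNge divr_ge0 ?wnorm_ge0 //.
      exact/ltW/cnorm_gt0.
    by exists p; [exact: ltnW | rewrite t5 t9 t6].
- by exists p => //; split=> // j jN; rewrite -r6 Iq.
Qed.

Lemma run_save s l : (l < vars s 0 + vars s 0)%N ->
  carr (run save s) 2 l 0 =
    carr s 0 l (vars s 5) - (l == vars s 0 + vars s 2)%N%:R.
Proof.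
move=> lr; rewrite /save run_seq; set t := run (For _ _ _) s.
have [v _ _] := run_agree _ s : agree _ s t.
have tl : carr t 2 l 0 = carr s 0 l (vars s 5).
  pose I m s' := forall l, (l < m)%N -> carr s' 2 l 0 = carr s 0 l (vars s 5).
  suff h : I (vars s 0 + vars s 0)%N t by apply: h.
  apply: (@run_for_ind _ I 4 (IAdd (IVar 0) (IVar 0))) => //= k s' _ [{}v _ rs] Is {lr}l.
  have r0 : reals s' 0 = reals s 0 by rewrite rs.
  have r1 : reals s' 1 = reals s 1 by rewrite rs.
  have v5 : vars s' 5 = vars s 5 by rewrite v.
  rewrite ltnS /carr /= !andbT leq_eqVlt => /orP[/eqP->|lk].
    by rewrite eqxx r0 r1 v5.
  by rewrite (ltn_eqF lk); apply: Is.
have t0 : vars t 0 = vars s 0 by rewrite v.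
have t2 : vars t 2 = vars s 2 by rewrite v.
move: tl; clearbody t; rewrite /carr /= t0 t2 andbT => -[<- <-].
by case: eqP => [->|_]; rewrite ?subr0 //; apply/eqP; rewrite eq_complex /= subr0 !eqxx.
Qed.

Lemma run_alpha s :
  carr (run alpha s) 4 0 0 =
    (\sum_(l < vars s 0) Num.conj (carr s 2 l 0) * carr s 0 l (vars s 3))
      * (reals s 9 0 0)^-1%:C%C.
Proof.
rewrite /alpha !run_seq; set s1 := run _ (run _ s); set t := run (For _ _ _) _.
have [v _ rs] := run_agree _ s1 : agree _ s1 t.
have t4 : carr t 4 0 0 =
    \sum_(l < vars s 0) Num.conj (carr s 2 l 0) * carr s 0 l (vars s 3).
  pose I m s' := carr s' 4 0 0 =
    \sum_(l < m) Num.conj (carr s 2 l 0) * carr s 0 l (vars s 3).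
  apply: (@run_for_ind _ I 4 (IVar 0)); first by rewrite /I big_ord0.
  move=> k s' _ [{}v _ {}rs]; rewrite /I big_ord_recr /= => <-.
  have [e0 e1 e2 e3] : [/\ reals s' 0 = reals s 0, reals s' 1 = reals s 1,
    reals s' 2 = reals s 2 & reals s' 3 = reals s 3] by rewrite !rs.
  have v3 : vars s' 3 = vars s 3 by rewrite v.
  rewrite /carr /= e0 e1 e2 e3 v3.
  by apply/eqP; rewrite eq_complex /=; apply/andP; split; apply/eqP; ring.
have t9 : reals t 9 = reals s 9 by rewrite rs.
rewrite -t4; clearbody t; rewrite /carr /= t9.
by apply/eqP; rewrite eq_complex /= !mulr0 subr0 add0r !eqxx.
Qed.

Lemma run_update s i j : (i < vars s 0 + vars s 0)%N ->
  carr (run update s) 0 i j = carr s 0 i j -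
    (if j == vars s 3 then carr s 2 i 0 * carr s 4 0 0 else 0).
Proof.
move=> ir; rewrite /update.
pose I m s' := forall i, carr s' 0 i j = carr s 0 i j -
    (if (i < m)%N && (j == vars s 3) then carr s 2 i 0 * carr s 4 0 0 else 0).
suff : I (vars s 0 + vars s 0)%N (run update s) by move=> ->; rewrite ir.
apply: (@run_for_ind _ I 4 (IAdd (IVar 0) (IVar 0))) => [|k s' _ [v _ rs] Is l].
  by move=> l; rewrite subr0.
have [e2 e3 e4 e5] : [/\ reals s' 2 = reals s 2, reals s' 3 = reals s 3,
    reals s' 4 = reals s 4 & reals s' 5 = reals s 5] by rewrite !rs.
have v3 : vars s' 3 = vars s 3 by rewrite v.
rewrite ltnS leq_eqVlt; have := Is l; rewrite /carr /= e2 e3 e4 e5 v3.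
case: (l =P k) => [->|_] /=; last by move=> ->.
case: (j =P vars s 3) => [->|_]; last by rewrite andbF => ->.
rewrite ltnn /= subr0 => -[-> ->].
by apply/eqP; rewrite eq_complex /=; apply/andP; split; apply/eqP; ring.
Qed.

Lemma run_eliminate s i j : (i < vars s 0 + vars s 0)%N -> (j < vars s 1)%N ->
  carr (run eliminate s) 0 i j = carr s 0 i j - carr s 2 i 0 *
    ((\sum_(l < vars s 0) Num.conj (carr s 2 l 0) * carr s 0 l j)
      * (reals s 9 0 0)^-1%:C%C).
Proof.
move=> ir jN.
set a := fun j => (\sum_(l < vars s 0) Num.conj (carr s 2 l 0) * carr s 0 l j)
      * (reals s 9 0 0)^-1%:C%C.
pose I m s' := forall i j, (i < vars s 0 + vars s 0)%N -> (j < vars s 1)%N ->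
  carr s' 0 i j = carr s 0 i j - if (j < m)%N then carr s 2 i 0 * a j else 0.
suff : I (vars s 1) (run eliminate s) by move=> ->; rewrite ?jN.
apply: (@run_for_ind _ I 3 (IVar 1)) => [|k s' kN [v _ rs] Is l m lr mN].
  by move=> *; rewrite subr0.
rewrite run_seq; set s1 := set_var s' 3 k.
have al := run_alpha s1; have [v' _ rs'] := run_agree alpha s1.
have [e2 e3 e9] : [/\ reals s1 2 = reals s 2, reals s1 3 = reals s 3 &
  reals s1 9 = reals s 9] by rewrite /= !rs.
have v0 : vars s1 0 = vars s 0 by rewrite /= v.
set t := run alpha s1 in al v' rs' *.
(* Column [k] is still untouched at this point, so its coefficient is computed from the original
   entries. *)
have {}al : carr t 4 0 0 = a k.
  rewrite al v0 e9 /a /carr e2 e3; congr (_ * _); apply: eq_bigr => p _.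
  congr (_ * _); have := Is p k; rewrite ltnn subr0; apply => //.
  by rewrite (leq_trans (ltn_ord p)) // leq_addr.
have t0 : vars t 0 = vars s 0 by rewrite v'.
have t3 : vars t 3 = k by rewrite v'.
have c2 : carr t 2 l 0 = carr s 2 l 0 by rewrite /carr !rs' // e2 e3.
have c0 : carr t 0 l m = carr s' 0 l m by rewrite /carr !rs'.
rewrite run_update ?t0 // t3 al c2 c0 Is // [(m < k.+1)%N]ltnS [(m <= k)%N]leq_eqVlt.
by case: (m =P k) => [->|_] /=; rewrite ?ltnn ?subr0.
Qed.

End Program.

(** * The program simulates the greedy selection within the stated cost *)

Section Correctness.

Variables (R : realType) (r N : nat) (V : 'M[R[i]]_(r, N)).
Hypothesis VV : V *m adjoint V = 1%:M.
Local Notation C := R[i].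
Implicit Type s : state R.

(** Only the products with [V] are in memory; [P] and [X] themselves exist in the proof alone. *)
Record stored s (k : nat) (P X : 'M[C]_r) (f : 'I_r -> 'I_N) : Prop := Stored {
  stored_P : forall (l : 'I_r) (j : 'I_N), carr s 0 l j = (P *m col j V) l 0;
  stored_X : forall (l : 'I_r) (j : 'I_N), carr s 0 (r + l) j = (X *m col j V) l 0;
  stored_f : forall l : 'I_r, (l < k)%N -> ints s 0 l = f l
}.

Lemma stored_input f : stored (input V) 0 1%:M 0 f.
Proof.
split=> // l j; rewrite /carr /= /entries.
  by rewrite ![insub (nat_of_ord _)]valK mul1mx !mxE; case: (V l j).
rewrite insubF ?mul0mx ?mxE //.
by rewrite ltnNge leq_addr.
Qed.

Lemma run_step s (k : 'I_r) P X f :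
  vars s 0 = r -> vars s 1 = N -> vars s 2 = k ->
  selected V k P X f -> stored s k P X f ->
  exists P' X' f', selected V k.+1 P' X' f' /\ stored (run step s) k.+1 P' X' f'.
Proof.
move=> s0 s1 s2 S [sP sX sf].
(* The value [f k] is itself a column index, so there is at least one column. *)
have N0 : (0 < vars s 1)%N.
  by rewrite s1; case: (f k) => i; apply: leq_ltn_trans.
have wE (j : 'I_N) : wnorm s j = fsq (P *m col j V).
  rewrite /wnorm s0; apply: eq_bigr => l _.
  by rewrite big_ord1 sP.
have cE (j : 'I_N) : cnorm s j = 1 + fsq (X *m col j V).
  rewrite /cnorm s0; congr (_ + _); apply: eq_bigr => l _.
  by rewrite big_ord1 sX.
have [p pN [t5 t9 pmax]] := run_pivot N0; rewrite s1 in pN pmax.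
pose i := Ordinal pN; rewrite -[p]/(val i) in t5 t9 pmax.
have {}pmax j : fsq (P *m col j V) / (1 + fsq (X *m col j V)) <=
    fsq (P *m col i V) / (1 + fsq (X *m col i V)).
  by rewrite -!wE -!cE pmax.
have := selectedS VV S pmax; rewrite /=.
set w := P *m col i V; set d := _ - delta_mx k 0.
set P' := P - _; set X' := X - _; set f' := fun l => _ => S'.
exists P', X', f'; split=> //.
rewrite /step 3!run_seq.
have [tv ti tr] := run_agree pivot s; set t := run pivot s in t5 t9 tv ti tr *.
have [t0 t1 t2 tU] : [/\ vars t 0 = r, vars t 1 = N, vars t 2 = k & carr t 0 = carr s 0].
  by rewrite /carr !tv ?tr.
have us := @run_save _ t; rewrite t0 t2 t5 tU in us.
have [uv ui ur] := run_agree save t; set u := run save t in us uv ui ur *.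
have [u0 u1 u2 uU] : [/\ vars u 0 = r, vars u 1 = N, vars u 2 = k & carr u 0 = carr s 0].
  by rewrite /carr !uv ?ur // -tU.
have ue := @run_eliminate _ u.
have [u9 u5] : reals u 9 0 0 = fsq w /\ vars u 5 = i by rewrite uv // ur // t9 wE.
rewrite u0 u1 u9 uU in ue.
have [xv xi xr] := run_agree eliminate u; set x := run eliminate u in ue xv xi xr *.
have [x2 x5] : vars x 2 = k /\ vars x 5 = i by rewrite !xv.
have lt_l (l : 'I_r) : (l < r + r)%N by rewrite (leq_trans (ltn_ord l)) ?leq_addr.
have lt_rl (l : 'I_r) : (r + l < r + r)%N by rewrite ltn_add2l.
have uw (l : 'I_r) : carr u 2 l 0 = w l 0.
  by rewrite us // sP ltn_eqF ?subr0 // (leq_trans (ltn_ord l)) ?leq_addr.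
have ud (l : 'I_r) : carr u 2 (r + l) 0 = d l 0.
  by rewrite us // sX eqn_add2l !mxE andbT.
have aw (j : 'I_N) : \sum_(l < r) Num.conj (carr u 2 l 0) * carr s 0 l j =
    (adjoint w *m col j V) 0 0.
  have wP : adjoint w *m P = adjoint w.
    by rewrite -{1}(sel_adj S) -adjointM mulmxA (sel_idem S).
  rewrite -wP -mulmxA mxE; apply: eq_bigr => l _.
  by rewrite uw sP !mxE.
have deflate (m : 'cV[C]_r) (l : 'I_r) (j : 'I_N) :
    (real_complex R (fsq w)^-1 *: (m *m adjoint w) *m col j V) l 0
    = m l 0 * ((adjoint w *m col j V) 0 0 * (fsq w)^-1%:C%C).
  rewrite -scalemxAl -mulmxA mxE [(_ *m (_ *m _)) _ _]mxE big_ord1.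
  by rewrite mulrCA; congr (_ * _); rewrite mulrC.
have xU l j : carr (run (SetInt 0 (IVar 2) (IVar 5)) x) 0 l j = carr x 0 l j by [].
split=> l.
- by move=> j; rewrite xU ue // sP uw aw mulmxBl [RHS]mxE [X in _ = _ + X]mxE deflate;
    congr (_ - _ * _).
- by move=> j; rewrite xU ue // sX ud aw mulmxBl [RHS]mxE [X in _ = _ + X]mxE deflate;
    congr (_ - _ * _).
- rewrite /= x2 x5 /f' ltnS leq_eqVlt -val_eqE /=.
  by case: eqP => //= lk {}/sf <-; rewrite xi // ui // ti.
Qed.

Lemma run_prog : (0 < N)%N ->
  exists P X f, selected V r P X f /\ stored (run prog (input V)) r P X f.
Proof.
move=> N0; pose I k s := exists P X f, selected V k P X f /\ stored s k P X f.
apply: (@run_for_ind _ I 2 (IVar 0) step (input V)).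
  exists 1%:M, 0, (fun _ => Ordinal N0).
  by split; [apply: selected0 | apply: stored_input].
move=> k s kr [v _ _] [P [X [f [S T]]]].
apply: (@run_step _ (Ordinal (kr : k < r)%N) P X f) => //=; try by rewrite v.
by case: T.
Qed.

Lemma prog_cost : (0 < N)%N -> (0 < r)%N ->
  ((exec prog (input V)).2 <= 1000 * (N * r ^ 2))%N.
Proof.
move=> N0 r0.
have -> : (1000 * (N * r ^ 2) = 1000 * (N * (r * r)))%N by rewrite -mulnn.
apply: leq_trans (@exec_cost _ [:: 0; 1]%N (vars (input V)) _ _ _ _ _) _ => //=.
(* The cost is a polynomial in the monomials 1, r, r^2, N r and N r^2, each at most N r^2; 1000
   exceeds the sum of its coefficients. *)
have h1 : (r <= r * r)%N by rewrite leq_pmulr.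
have h2 : (r * r <= N * (r * r))%N by rewrite leq_pmull.
have h3 : (N * r <= N * (r * r))%N by rewrite leq_mul2l h1 orbT.
nia.
Qed.

End Correctness.

Theorem theorem5 :
  exists (p : cmd) (c : nat),
  forall (R : realType) (r N : nat) (V : 'M[R[i]]_(r, N)),
    (0 < r)%N ->
    V *m adjoint V = 1%:M ->
    ((exec p (input V)).2 <= c * (N * r ^ 2))%N /\
    exists f : 'I_r -> 'I_N,
      [/\ injective f,
          forall k : 'I_r, output (exec p (input V)).1 k = f k,
          colsub f V \in unitmx,
          frobnorm (invmx (colsub f V))
            <= Num.sqrt (r%:R * (N%:R - r%:R + 1)) &
          specnorm (invmx (colsub f V))
            <= Num.sqrt (1 + r%:R * (N%:R - r%:R))].
Proof.
exists prog, 1000%N => R r N V r0 VV.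
(* With no columns the product with the adjoint would be 0, not the identity of size r > 0. *)
have N0 : (0 < N)%N.
  case: N V VV => // V /matrixP/(_ (Ordinal r0) (Ordinal r0)) /eqP.
  by rewrite !mxE big_ord0 eqxx eq_sym oner_eq0.
split; first exact: prog_cost.
have [P [X [f [S T]]]] := run_prog VV N0.
have XV := selected_inv S; have [VU UV] := mulmx1_unit XV.
have invE : invmx (colsub f V) = X.
  by rewrite -[LHS]mul1mx -XV -mulmxA mulmxV ?mulmx1.
have f_inj : injective f.
  move=> l l' ff; have := sel_Xf S (ltn_ord l'); rewrite -ff (sel_Xf S (ltn_ord l)).
  move=> /matrixP/(_ l 0); rewrite !mxE !eqxx andbT; case: eqP => // _ /eqP.
  by rewrite oner_eq0.
have rN : (r <= N)%N by have := leq_card f f_inj; rewrite !card_ord.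
(* At k = r the factor of [fsq X] in the invariant is 1. *)
have Xb : fsq X <= r%:R * (N%:R - r%:R + 1) by have := sel_bound S; lra.
exists f; split=> //.
- by move=> k; apply: (stored_f T).
- rewrite invE frobnormE ler_sqrt //; apply: le_trans Xb; exact: fsq_ge0.
(* The selector is the corresponding column submatrix of the identity, and 1 + r(N - r) + (r - 1) =
   r(N - r + 1) is the Frobenius bound. *)
- rewrite invE; apply: (@specnorm_le _ _ _ _ V (colsub f 1%:M)) => //.
  + apply/matrixP=> i j; rewrite !mxE (bigD1 (f i)) //= big1 => [|l li].
      by rewrite !mxE eqxx conjC1 mul1r addr0 (inj_eq f_inj).
    by rewrite !mxE (negPf li) conjC0 mul0r.
  + by rewrite mulmx_colsub mulmx1; apply: mulmx1C.
  + move: Xb; lra.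
  + by rewrite addr_ge0 // mulr_ge0 // ?ler0n // subr_ge0 ler_nat.
Qed.
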